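(* For every nonzero real number $x$, $$\left.\frac{\partial W_{\alpha,\beta}(x)}{\partial\alpha}\right|_{\alpha=1,\ \beta=2}=\frac{1}{2x}I_0(2\sqrt x)-\frac{1}{\sqrt x}I_1(2\sqrt x)-\frac12\ln x\,I_2(2\sqrt x)-K_2(2\sqrt x).$$
   Context: The Wright function is $W_{\alpha,\beta}(x)=\sum_{k=0}^\infty\frac{x^k}{k!\,\Gamma(\alpha k+\beta)}$ (with $1/\Gamma=0$ at the poles of $\Gamma$), so that $\frac{\partial W_{\alpha,\beta}(x)}{\partial\alpha}=-\sum_{k=1}^\infty\frac{\psi(\alpha k+\beta)}{k!\,\Gamma(\alpha k+\beta)}\,k\,x^k$, with $\psi=\Gamma'/\Gamma$ the digamma function. $I_\nu$ and $K_\nu$ are the modified Bessel functions of the first and second kind. For $x<0$, $\ln x$ and $\sqrt x$ denote principal branches. *)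

(* Defs.v *)
From HB Require Import structures.
From mathcomp Require Export all_boot all_order all_algebra.
From mathcomp Require Export all_classical all_reals all_analysis.
From mathcomp Require Export complex.

Set Implicit Arguments.
Unset Strict Implicit.
Unset Printing Implicit Defensive.

Import Order.TTheory GRing.Theory Num.Theory.
Import numFieldNormedType.Exports.

Local Open Scope classical_set_scope.
Local Open Scope ring_scope.
Local Open Scope complex_scope.

Section Gamma.
Variable R : realType.
Implicit Types x : R.

Definition Gamma_integral x : R :=
  (\int[lebesgue_measure]_(t in `]0%R, +oo[) (t `^ (x - 1) * expR (- t)))%R.

(* The least n with 0 < x + n. *)
Definition Gamma_shift x : nat := if 0 < x then 0%N else (Num.truncn (- x)).+1.

(* Euler's integral, continued to the negative axis by
   Gamma (x + n) = x (x + 1) ... (x + n - 1) Gamma x.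
   At a pole the denominator vanishes, so Gamma x = 0 and hence
   (Gamma x)^-1 = 0: the convention 1 / Gamma = 0 at the poles is built in. *)
Definition Gamma x : R :=
  Gamma_integral (x + (Gamma_shift x)%:R) /
  \prod_(i < Gamma_shift x) (x + i%:R).

Definition wright (a b x : R) : R :=
  limn (series (fun k : nat => x ^+ k / (k`!%:R * Gamma (a * k%:R + b)))).

End Gamma.

(* The topology of a numerical field is not inferred from the bare type R[i]. *)
Definition Cplx (R : realType) : numClosedFieldType := R[i].

Section Bessel.
Variable R : realType.
Local Notation C := (Cplx R).
Implicit Types (z : C) (nu : R).

Definition toC (a : R) : C := a%:C.

Definition csqrt z : C := sqrtc z.

Definition cexp z : C :=
  toC (expR (complex.Re z)) * (cos (complex.Im z) +i* sin (complex.Im z) : C).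

(* Principal argument, in ]-pi, pi] for z != 0. *)
Definition carg z : R :=
  let t := acos (complex.Re z / Normc.normc z) in if 0 <= complex.Im z then t else - t.

Definition clog z : C := ln (Normc.normc z) +i* carg z.

Definition cpow z nu : C :=
  if z == 0 then (nu == 0)%:R else cexp (toC nu * clog z).

Definition besselI nu z : C :=
  cpow (z / 2) nu *
  limn (series (fun k : nat =>
    (z ^+ 2 / 4) ^+ k / (k`!%:R * toC (Gamma (nu + k%:R + 1))))).

Definition besselK_quot nu z : C :=
  toC (pi / 2) * (besselI (- nu) z - besselI nu z) / toC (sin (nu * pi)).

(* sin (nu * pi) = 0 exactly at the integer orders, where K_nu is defined as
   the limit over the neighbouring orders. *)
Definition besselK nu z : C :=
  if sin (nu * pi) == 0 then lim (besselK_quot mu z @[mu --> nu^'])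
  else besselK_quot nu z.

End Bessel.

(* Main.v *)
Require Import Defs.
From mathcomp Require Import measurable_realfun.
From mathcomp Require Import ring lra.
Import Order.TTheory GRing.Theory Num.Theory.
Import numFieldNormedType.Exports.
Local Open Scope classical_set_scope.
Local Open Scope ring_scope.

Set Implicit Arguments.
Unset Strict Implicit.
Unset Printing Implicit Defensive.

(** Put S(nu) = sum_k x^k / (k! Gamma(nu + k + 1)) ([bessel_sum]).  Since
    (2 sqrt x)^2 / 4 = x is real also for x < 0, the Bessel function
    I_nu(2 sqrt x) is (sqrt x)^nu S(nu), where only the power is complex.  So the
    theorem is about derivatives with respect to the parameter of real series in
    1 / Gamma, and both sides turn out to be x S'(2).

    The left side: differentiating the Wright series termwise at alpha = 1
    gives sum_k x^k / k! k (1 / Gamma)'(k + 2), and k x^k / k! = x x^(k-1) / (k-1)!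
    makes this x S'(2) ([is_derive_wright]).

    The right side: 1 / Gamma(s) = s / Gamma(s + 1) holds for all real s, poles
    included, hence S(nu - 1) = nu S(nu) + x S(nu + 1) ([bessel_sum_pred]).  This
    recurrence carries differentiability from nu = 2, 3 down to nu = -2; once
    differentiated, it gives S'(-2) = 2 x S(1) - S(0) + x^2 S'(2)
    ([is_derive_bessel_N2]), in which the unknown derivatives at the orders
    between cancel.  By l'Hopital's rule, K_2(2 sqrt x) is half the derivative at mu = 2 of
    (sqrt x)^(-mu) S(-mu) - (sqrt x)^mu S(mu), and ln (sqrt x) = (ln x) / 2 for the
    principal branches ([csqrt_cpolar]), so that
      K_2 = S(0) / (2 x) - S(1) - x S'(2) - (1/2) (ln x) x S(2)
    ([besselK2_cpolar]).  Inserting this in the right side leaves x S'(2).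

    The analytic input is the regularity of 1 / Gamma on [2, +oo[.  All of it
    comes from Wendel's inequality Gamma(s + h) <= s^h Gamma(s), 0 <= h <= 1
    ([wendel]), and the functional equation: they make 1 / Gamma bounded and
    Lipschitz ([rgamma_lipschitz]), which dominates the difference quotients of
    the series ([is_derive_series]), and they confine the difference quotients
    at 2 to intervals as short as one likes, whence differentiability there
    ([derivable_rgamma2]). *)

(** * Euler's integral *)

Section EulerIntegral.
Variable R : realType.
Implicit Types (s t h : R) (n : nat).
Local Notation mu := (@lebesgue_measure R).

Lemma derivable_continuous_at (f : R -> R) t :
  derivable f t 1 -> {for t, continuous f}.
Proof. by move=> /derivable1_diffP/differentiable_continuous. Qed.

Definition euler s t : R := t `^ (s - 1) * expR (- t).

Lemma euler_ge0 s t : 0 <= euler s t.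
Proof. by rewrite mulr_ge0 ?powR_ge0 ?expR_ge0. Qed.

Lemma ln_le_sub1 t : 0 < t -> ln t <= t - 1.
Proof.
move=> t0; have := @le_ln1Dx R (t - 1); rewrite addrCA subrr addr0; apply.
by lra.
Qed.

Lemma is_derive_powRexp s t : 0 < t ->
  is_derive t 1 (fun u => u `^ s * expR (- u))
    (s * euler s t - euler (s + 1) t).
Proof.
move=> t0.
have H1 := is_derive1_powR s t0.
have H2 : is_derive t (1:R) (fun u : R => expR (- u)) (- expR (- t)).
  by apply: is_derive_eq; rewrite /GRing.scale /=; ring.
have := is_deriveM H1 H2.
move/is_derive_eq; apply.
by rewrite /euler addrK /GRing.scale /=; ring.
Qed.

Lemma continuous_powRexp s t : 0 < t ->
  {for t, continuous (fun u => u `^ s * expR (- u))}.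
Proof.
move=> t0; apply: derivable_continuous_at; by have [] := is_derive_powRexp s t0.
Qed.

Lemma measurable_euler (D : set R) s : measurable_fun D (EFin \o euler s).
Proof.
apply/measurable_EFinP; apply: measurable_funM.
  by apply: measurable_funTS; exact: measurable_powR.
apply: measurable_funTS; apply: measurableT_comp => //.
Qed.

(** By ln u <= u - 1 at u = t / (2 s), the factor t^s costs at most half of the
    exponential decay. *)
Lemma powR_expR_le s t : 0 < s -> 0 < t ->
  t `^ s * expR (- t) <= (2 * s) `^ s * expR (- (2^-1 * t)).
Proof.
move=> s0 t0; have s20 : 0 < 2 * s by rewrite mulr_gt0.
rewrite /powR !gt_eqF // -!expRD ler_expR.
have : ln (t / (2 * s)) <= t / (2 * s) - 1 by rewrite ln_le_sub1 ?divr_gt0.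
rewrite ln_div ?posrE // -(ler_pM2l s0).
have -> : s * (t / (2 * s) - 1) = t / 2 - s by field; rewrite gt_eqF.
by lra.
Qed.

Local Open Scope ereal_scope.

Definition euler_int s : \bar R := \int[mu]_(t in `]0%R, +oo[) (euler s t)%:E.

Lemma integral_expRN (r : R) : (0 < r)%R ->
  \int[mu]_(t in `]0%R, +oo[) (expR (- (r * t)))%:E = (r^-1)%:E.
Proof.
move=> r0.
have d (t : R) : is_derive t (1%R : R)
    (fun u : R => - (r^-1 * expR (- (r * u))))%R (expR (- (r * t))).
  apply: is_derive_eq; rewrite /GRing.scale /= ?mulr1; field.
  by rewrite gt_eqF.
have dc (t : R) : {for t, continuous (fun u : R => expR (- (r * u)))}.
  by apply: derivable_continuous_at; exact: ex_derive.
rewrite integral_itv_obnd_cbnd; last first.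
  by apply/measurable_EFinP; apply: measurable_funTS; apply: continuous_measurable_fun => t; exact: dc.
rewrite (@ge0_continuous_FTC2y _ _ (fun u : R => - (r^-1 * expR (- (r * u))))%R _ 0%R).
- by rewrite mulr0 oppr0 expR0 mulr1 EFinN oppeK add0e.
- by move=> t _; rewrite expR_ge0.
- by apply: continuous_subspaceT => t; exact: dc.
- rewrite -oppr0; apply: cvgN; rewrite -(mulr0 (r^-1)%R); apply: cvgMr.
  apply: (@cvg_comp _ _ _ (fun t : R => (r * t)%R) (fun t => expR (- t)%R) _
    (pinfty_nbhs R)); last exact: cvgr_expR.
  exact: gt0_cvgMry.
- by move=> t _; exact: ex_derive.
- apply/cvg_at_right_filter.
  exact: (derivable_continuous_at (t := 0%R) (@ex_derive _ _ _ _ _ _ _ (d 0%R))).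
- by move=> t _; rewrite derive1E; exact: derive_val.
Qed.

Lemma euler_int_ge0 s : 0 <= euler_int s.
Proof. by apply: integral_ge0 => t _; rewrite lee_fin euler_ge0. Qed.

Lemma euler_int1 : euler_int 1 = 1.
Proof.
rewrite -[RHS]/(1%:E) -[in RHS]invr1 -integral_expRN//; apply: eq_integral => t _.
by rewrite /euler subrr powRr0 !mul1r.
Qed.

Lemma euler_int_ge1_fin s : (1 <= s)%R -> euler_int s \is a fin_num.
Proof.
move=> s1; rewrite ge0_fin_numE ?euler_int_ge0//.
have [->|s_neq1] := eqVneq s 1%R; first by rewrite euler_int1 ltry.
pose C : R := ((2 * (s - 1)) `^ (s - 1))%R.
apply: (@le_lt_trans _ _ (\int[mu]_(t in `]0%R, +oo[) (C * expR (- (2^-1 * t)))%:E)).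
  apply: ge0_le_integral => //=.
  - by move=> t _; rewrite lee_fin euler_ge0.
  - exact: measurable_euler.
  - apply/measurable_EFinP; apply: measurable_funTS; apply: continuous_measurable_fun => t.
    by apply: derivable_continuous_at; exact: ex_derive.
  - move=> t; rewrite /= in_itv/= andbT => t0; rewrite lee_fin.
    by apply: powR_expR_le => //; rewrite subr_gt0 lt_neqAle eq_sym s_neq1.
under eq_integral do rewrite EFinM.
rewrite ge0_integralZl//=; do ?[by move=> *; rewrite lee_fin ?expR_ge0 ?powR_ge0].
- by rewrite integral_expRN ?ltry// invr_gt0.
- apply/measurable_EFinP; apply: measurable_funTS; apply: continuous_measurable_fun => t.
  by apply: derivable_continuous_at; exact: ex_derive.
Qed.

(** The intervals [1 / (n + 2), n + 2] are nondegenerate and exhaust ]0, +oo[; on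
   them the integrands are continuous, also when s < 1. *)
Let a_ n : R := (n.+2%:R)^-1%R.
Let b_ n : R := n.+2%:R.

Let a_gt0 n : (0 < a_ n)%R. Proof. by rewrite invr_gt0 ltr0n. Qed.

Let a_lt1 n : (a_ n < 1)%R.
Proof. by rewrite invf_lt1 ?ltr0n// ltr1n. Qed.

Let a_lt_b n : (a_ n < b_ n)%R.
Proof. by rewrite (lt_trans (a_lt1 n))// ltr1n. Qed.

Let cvg_b : b_ n @[n --> \oo] --> +oo%R.
Proof.
apply/cvgryPge => A; near=> n; apply: (@le_trans _ _ (n%:R)).
  by near: n; exact: nbhs_infty_ger.
by rewrite ler_nat -addn2 leq_addr.
Unshelve. all: by end_near. Qed.

Let cvg_a : a_ n @[n --> \oo] --> 0%R.
Proof.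
apply: (gtr0_cvgV0 _).2; last exact: cvg_b.
by apply: nearW => n; rewrite ltr0n.
Qed.

Let bigcup_ab : \bigcup_n `[a_ n, b_ n]%classic = `]0%R, +oo[%classic :> set R.
Proof.
apply/seteqP; split => [t [n _]|t] /=; rewrite !in_itv/= ?andbT.
  by move=> /andP[at_ _]; exact: lt_le_trans at_.
move=> t0; near \oo => n; exists n => //=; rewrite in_itv/=; apply/andP; split.
  by near: n; move/cvgr_le: cvg_a; apply.
by near: n; move/cvgryPge: cvg_b; apply.
Unshelve. all: by end_near. Qed.

Let J s n : \bar R := \int[mu]_(t in `[a_ n, b_ n]) (euler s t)%:E.

Let cvg_J s : J s n @[n --> \oo] --> euler_int s.
Proof.
rewrite /euler_int -bigcup_ab; apply: ge0_nondecreasing_set_cvg_integral => //=.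
- apply/nondecreasing_seqP => n; apply/subsetPset; apply: subset_itvScc; rewrite bnd_simp.
  + by rewrite lef_pV2 ?posrE ?ltr0n// ler_nat.
  + by rewrite ler_nat.
- by move=> n; exact: measurable_euler.
- by move=> n t _; rewrite lee_fin euler_ge0.
Qed.

Let within_euler s n : {within `[a_ n, b_ n], continuous (euler s)}.
Proof.
apply: continuous_in_subspaceT => t; rewrite inE /= in_itv/= => /andP[at_ _].
by apply: continuous_powRexp; exact: lt_le_trans at_.
Qed.

Let integrable_J s n : mu.-integrable `[a_ n, b_ n] (EFin \o euler s).
Proof.
by apply: continuous_compact_integrable; [exact: segment_compact|exact: within_euler].
Qed.

(** The fundamental theorem of calculus for the derivative of t^s e^(-t); the
    boundary terms stay on the side where they are nonnegative. *)
Let JS s n : J (s + 1) n + (b_ n `^ s * expR (- b_ n))%:E =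
  s%:E * J s n + (a_ n `^ s * expR (- a_ n))%:E.
Proof.
have cF t : (0 < t)%R -> {for t, continuous (fun u : R => u `^ s * expR (- u))%R}.
  exact: continuous_powRexp.
have itv t : t \in `]a_ n, b_ n[%R -> (0 < t)%R.
  by rewrite in_itv/= => /andP[/(lt_trans (a_gt0 n))].
pose F (u : R) := (u `^ s * expR (- u))%R.
have cf : {within `[a_ n, b_ n], continuous (fun t => s * euler s t - euler (s + 1) t)%R}.
  move=> t; apply: cvgB; last exact: within_euler.
  by apply: cvgMr; exact: within_euler.
have dF : derivable_oo_LRcontinuous F (a_ n) (b_ n).
  split.
  + by move=> t /itv t0; have [] := is_derive_powRexp s t0.
  + by apply/cvg_at_right_filter; exact: cF.
  + by apply/cvg_at_left_filter; apply: cF; rewrite ltr0n.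
have F'E : {in `]a_ n, b_ n[%R, derive1 F =1 (fun t => s * euler s t - euler (s + 1) t)%R}.
  by move=> t /itv t0; rewrite derive1E; have [] := is_derive_powRexp s t0.
have := continuous_FTC2 (a_lt_b n) cf dF F'E.
under eq_integral do rewrite EFinB EFinM.
have iZ : mu.-integrable `[a_ n, b_ n] (fun t => s%:E * (euler s t)%:E).
  by apply: integrableZl => //; exact: integrable_J.
rewrite (integralB _ iZ (integrable_J (s + 1) n))//.
rewrite integralZl//; last exact: integrable_J.
have f1 : J s n \is a fin_num by apply: integrable_fin_num => //; exact: integrable_J.
have f2 : J (s + 1) n \is a fin_num by apply: integrable_fin_num => //; exact: integrable_J.
rewrite -!/(J _ _) -(fineK f1) -(fineK f2) -!EFinM -!EFinB -!EFinD => -[h].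
congr EFin; move: h; rewrite /F.
set u1 := fine _; set u2 := fine _; set v1 := (_ `^ s * _)%R; set v2 := (_ `^ s * _)%R.
lra.
Qed.

Let cvg_bpow s : (0 < s)%R -> (b_ n `^ s * expR (- b_ n))%R @[n --> \oo] --> 0%R.
Proof.
move=> s0; pose C : R := ((2 * s) `^ s)%R.
apply: (@squeeze_cvgr _ _ _ _ (cst 0%R) (fun n => C * expR (- (2^-1 * b_ n)))%R).
- apply: nearW => n; rewrite mulr_ge0 ?powR_ge0 ?expR_ge0//=.
  by rewrite powR_expR_le// ltr0n.
- exact: cvg_cst.
- rewrite -(mulr0 C); apply: cvgMr.
  apply: (@cvg_comp _ _ _ (fun n => 2^-1 * b_ n)%R (fun t => expR (- t)%R) _
    (pinfty_nbhs R)); last exact: cvgr_expR.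
  apply: (@cvg_comp _ _ _ b_ (fun r => 2^-1 * r)%R _ (pinfty_nbhs R)) cvg_b _.
  by apply: gt0_cvgMry; rewrite ?invr_gt0.
Qed.

Let cvg_apow s : (0 < s)%R -> (a_ n `^ s * expR (- a_ n))%R @[n --> \oo] --> 0%R.
Proof.
move=> s0.
apply: (@squeeze_cvgr _ _ _ _ (cst 0%R) (fun n => a_ n `^ s)%R).
- apply: nearW => n; rewrite mulr_ge0 ?powR_ge0 ?expR_ge0//=.
  by rewrite ler_piMr ?powR_ge0// expR_le1 oppr_le0 ltW.
- exact: cvg_cst.
- have := powR_cvg0 s0; move/cvg_at_rightP; apply; split => //.
Qed.

(** Letting the ends tend to 0 and +oo works in the extended reals, as all terms
    are nonnegative, so that finiteness can be deduced from it. *)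
Lemma euler_intS s : (0 < s)%R -> euler_int (s + 1) = s%:E * euler_int s.
Proof.
move=> s0.
have L : J (s + 1) n + (b_ n `^ s * expR (- b_ n))%:E @[n --> \oo] -->
    euler_int (s + 1) + 0%:E.
  apply: cvgeD; [by rewrite fin_num_adde_defl|exact: cvg_J|].
  by apply: cvg_EFin; [exact: nearW|exact: cvg_bpow].
have M : s%:E * J s n + (a_ n `^ s * expR (- a_ n))%:E @[n --> \oo] -->
    s%:E * euler_int s + 0%:E.
  apply: cvgeD; [by rewrite fin_num_adde_defl| |].
    by apply: cvgeZl => //; exact: cvg_J.
  by apply: cvg_EFin; [exact: nearW|exact: cvg_apow].
rewrite -[LHS]adde0 -[RHS]adde0; apply: cvg_unique M => //.
by move: L; rewrite (funext (JS s)).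
Qed.

(** For s < 1 the integrand is unbounded at 0, and finiteness is inherited from
    s + 1 >= 1. *)
Lemma euler_int_fin s : (0 < s)%R -> euler_int s \is a fin_num.
Proof.
move=> s0; have : euler_int (s + 1) \is a fin_num.
  by rewrite euler_int_ge1_fin ?lerDr ?ltW// ler_wpDl ?ltW.
rewrite euler_intS// ge0_fin_numE ?mule_ge0 ?lee_fin ?(ltW s0) ?euler_int_ge0// => h.
rewrite ge0_fin_numE ?euler_int_ge0//.
move: h; case: (euler_int s) (euler_int_ge0 s) => [r _ _|//|//]; first exact: ltry.
by rewrite mulry gtr0_sg// mul1e.
Qed.

End EulerIntegral.

(** * Wendel's inequality *)

Section RealGamma.
Variable R : realType.
Implicit Types (s t h u : R) (n m : nat).
Local Notation mu := (@lebesgue_measure R).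

Lemma Gamma_integralE s : 0 < s -> (Gamma_integral s)%:E = euler_int s.
Proof. by move=> s0; rewrite -[RHS]fineK ?euler_int_fin. Qed.

Lemma Gamma_integral1 : Gamma_integral 1 = 1 :> R.
Proof. by apply: EFin_inj; rewrite Gamma_integralE// euler_int1. Qed.

Lemma Gamma_integralS s : 0 < s ->
  Gamma_integral (s + 1) = s * Gamma_integral s.
Proof.
move=> s0; apply: EFin_inj.
by rewrite EFinM !Gamma_integralE ?euler_intS// addr_gt0.
Qed.

(** Weighted arithmetic-geometric inequality, as ln lies below its tangent
    lines. *)
Lemma powR_le_affine u h : 0 < u -> 0 <= h <= 1 -> u `^ h <= 1 - h + h * u.
Proof.
move=> u0 /andP[h0 h1]; set v := _ + _.
have v0 : 0 < v.
  have hu : 0 <= h * u by rewrite mulr_ge0// ltW.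
  have [he|hn0] := eqVneq h 0; first by rewrite /v he; lra.
  have : 0 < h * u by rewrite mulr_gt0// lt_neqAle eq_sym hn0.
  rewrite /v; lra.
rewrite /powR gt_eqF// -[leRHS]lnK ?posrE// ler_expR.
have l1 := ln_le_sub1 (divr_gt0 u0 v0).
have v1 : 0 < v^-1 by rewrite invr_gt0.
have l2 := ln_le_sub1 v1.
move: l1 l2; rewrite ln_div ?posrE// lnV ?posrE// => l1 l2.
have e : h * (u / v - 1) + (1 - h) * (v^-1 - 1) = 0.
  have : v != 0 by rewrite gt_eqF.
  by rewrite /v => ?; field.
have : h * (ln u - ln v) + (1 - h) * (- ln v) <= 0.
  rewrite -[leRHS]e lerD// ler_wpM2l//; lra.
lra.
Qed.

(** Wendel's inequality: in the integral, bound the geometric mean (t / s)^h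
    by the arithmetic mean 1 - h + h t / s. *)
Lemma wendel s h : 0 < s -> 0 <= h <= 1 ->
  Gamma_integral (s + h) <= s `^ h * Gamma_integral s.
Proof.
move=> s0 h01; have /andP[h0 h1] := h01.
have sh0 : 0 < s + h by lra.
have s10 : 0 < s + 1 by lra.
pose a := s `^ h * (1 - h); pose b := s `^ h * (h / s).
have a0 : 0 <= a by rewrite mulr_ge0 ?powR_ge0// subr_ge0.
have b0 : 0 <= b by rewrite mulr_ge0 ?powR_ge0// divr_ge0// ltW.
have -> : s `^ h * Gamma_integral s = a * Gamma_integral s + b * Gamma_integral (s + 1).
  by rewrite Gamma_integralS// /a /b; field; rewrite gt_eqF.
rewrite -lee_fin EFinD !EFinM !Gamma_integralE// /euler_int.
rewrite -!ge0_integralZl//;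
  [|by move=> *; rewrite ?lee_fin ?euler_ge0//; exact: measurable_euler..].
rewrite -ge0_integralD//; last 4 first.
- by move=> t _; rewrite -EFinM lee_fin mulr_ge0// euler_ge0.
- by apply: measurable_funeM; exact: measurable_euler.
- by move=> t _; rewrite -EFinM lee_fin mulr_ge0// euler_ge0.
- by apply: measurable_funeM; exact: measurable_euler.
apply: ge0_le_integral => //=.
- by move=> t _; rewrite lee_fin euler_ge0.
- exact: measurable_euler.
- by apply: emeasurable_funD; apply: measurable_funeM; exact: measurable_euler.
move=> t; rewrite /= in_itv/= andbT => t0; rewrite -!EFinM -EFinD lee_fin.
rewrite /euler.
have tn : t != 0 by rewrite gt_eqF.
have -> : t `^ (s + h - 1) = t `^ h * t `^ (s - 1).
  by rewrite -powRD ?tn ?implybT//; congr (_ `^ _); ring.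
have -> : t `^ (s + 1 - 1) = t * t `^ (s - 1).
  by rewrite addrK mulr_powRB1// ltW.
have -> : t `^ h = s `^ h * (t / s) `^ h.
  rewrite -powRM ?divr_ge0 ?ltW//; congr (_ `^ _).
  by field; rewrite gt_eqF.
have := powR_le_affine (divr_gt0 t0 s0) h01.
move=> /(ler_wpM2l (mulr_ge0 (powR_ge0 s h)
  (mulr_ge0 (powR_ge0 t (s - 1)) (expR_ge0 (- t))))).
rewrite /a /b; set X := powR _ _; set Y := powR _ _; set Z := powR _ _; set W := expR _.
congr (_ <= _); ring.
Qed.

Lemma Gamma_integral_nat_gt0 n : 0 < Gamma_integral (n.+1%:R : R).
Proof.
elim: n => [|n IH]; first by rewrite Gamma_integral1.
by rewrite -[n.+2]addn1 natrD Gamma_integralS// mulr_gt0.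
Qed.

(** By Wendel's inequality a zero at s would force a zero at the next integer,
    where the value is a factorial. *)
Lemma Gamma_integral_gt0 s : 0 < s -> 0 < Gamma_integral s.
Proof.
move=> s0; have /andP[l1 l2] := truncn_itv (ltW s0).
have := @wendel s ((Num.truncn s).+1%:R - s) s0.
rewrite addrCA subrr addr0 => /(_ _)/(lt_le_trans (Gamma_integral_nat_gt0 _)).
rewrite pmulr_rgt0 ?powR_gt0//; apply.
move: l2; rewrite -natr1 => l2; apply/andP; split; lra.
Qed.

End RealGamma.

(** * The reciprocal Gamma function is bounded and Lipschitz *)

Section ReciprocalGamma.
Variable R : realType.
Implicit Types (s t h c : R) (n m : nat).

Definition rgamma s : R := (Gamma s)^-1.

Lemma Gamma_gt0E s : 0 < s -> Gamma s = Gamma_integral s.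
Proof. by move=> s0; rewrite /Gamma /Gamma_shift s0 big_ord0 divr1 addr0. Qed.

Lemma Gamma_shiftS s : s <= 0 -> Gamma_shift s = (Gamma_shift (s + 1)).+1.
Proof.
move=> s0; rewrite /Gamma_shift ltNge s0 /=; case: ltP => s1.
  by congr _.+1; apply/eqP; rewrite truncn_eq ?oppr_ge0//=; lra.
congr _.+1; have -> : - s = 1 + (- (s + 1)) by ring.
by rewrite truncnD ?truncn1 ?rpred1 ?nnegrE ?oppr_ge0.
Qed.

(** It holds at the poles too: the value of Gamma there is 0 by convention, and
    then so is its inverse, while the factor s is 0 when s + 1 is not a pole. *)
Lemma rgammaS s : rgamma s = s * rgamma (s + 1).
Proof.
have [s0|s0] := ltP 0 s.
  rewrite /rgamma !Gamma_gt0E ?addr_gt0// Gamma_integralS// invfM mulrA.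
  by rewrite divff ?mul1r// gt_eqF.
rewrite /rgamma /Gamma Gamma_shiftS// big_ord_recl /= addr0.
set n := Gamma_shift _.
have -> : s + n.+1%:R = s + 1 + n%:R by rewrite -natr1; ring.
rewrite !invf_div -mulrA; congr (_ * (_ / _)).
by apply: eq_bigr => i _; rewrite /bump /= add1n -natr1; ring.
Qed.

Lemma rgamma_gt0 s : 0 < s -> 0 < rgamma s.
Proof. by move=> s0; rewrite invr_gt0 Gamma_gt0E// Gamma_integral_gt0. Qed.

Lemma rgamma1 : rgamma 1 = 1.
Proof. by rewrite /rgamma Gamma_gt0E// Gamma_integral1 invr1. Qed.

Lemma rgamma2 : rgamma 2 = 1.
Proof. by have := rgammaS 1; rewrite rgamma1 mul1r. Qed.

Lemma rgamma_wendel s h : 0 < s -> 0 <= h <= 1 ->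
  rgamma s <= s `^ h * rgamma (s + h).
Proof.
move=> s0 h01; have sh0 : 0 < s + h by case/andP: h01 => ? ?; lra.
rewrite /rgamma !Gamma_gt0E// ler_pdivlMr ?Gamma_integral_gt0// mulrC.
by rewrite ler_pdivrMr ?Gamma_integral_gt0// wendel.
Qed.

(** Wendel's inequality over the remaining distance 1 - h to s + 1, combined
    with the functional equation. *)
Lemma rgamma_wendel_lower s h : 0 < s - 1 + h -> 0 <= h <= 1 ->
  (s - 1 + h) `^ h * rgamma (s + h) <= rgamma s.
Proof.
move=> c0 h01; set c := s - 1 + h.
have := @rgamma_wendel c (1 - h) c0.
have -> : c + (1 - h) = s by rewrite /c; ring.
rewrite rgammaS; have -> : c + 1 = s + h by rewrite /c; ring.
have cn : c != 0 by rewrite gt_eqF.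
have cE : c = c `^ (1 - h) * c `^ h.
  by rewrite -powRD ?cn ?implybT// subrK powRr1 ?ltW.
rewrite [X in X * rgamma (s + h)]cE -mulrA ler_pM2l ?powR_gt0//; apply.
by case/andP: h01 => ? ?; lra.
Qed.

Lemma powR_ge1 c h : 1 <= c -> 0 <= h -> 1 <= c `^ h.
Proof. by move=> c1 h0; rewrite -(powRr0 c) ler_powR. Qed.

Lemma rgamma_step_le s h : 2 <= s -> 0 <= h <= 1 -> rgamma (s + h) <= rgamma s.
Proof.
move=> s2 h01; have /andP[h0 h1] := h01.
apply: le_trans (rgamma_wendel_lower _ h01); last by lra.
rewrite ler_peMl ?powR_ge1//; last by lra.
by rewrite ltW// rgamma_gt0//; lra.
Qed.

(** A step of length at most 1 covers [2, 3]; beyond, the functional equation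
    divides by s - 1 >= 1. *)
Lemma rgamma_le1 s : 2 <= s -> rgamma s <= 1.
Proof.
move=> s2; have : s <= 3 + (Num.truncn s)%:R.
  have /andP[_] := truncn_itv (le_trans (ler0n R 2) s2); rewrite -natr1; lra.
move: (Num.truncn s) => n0; elim: n0 s s2 => [|n IH] s s2 sn.
  have := @rgamma_step_le 2 (s - 2) (lexx _).
  by rewrite addrCA subrr addr0 rgamma2; apply; apply/andP; split; lra.
have [s3|s3] := leP s 3.
  have := @rgamma_step_le 2 (s - 2) (lexx _).
  by rewrite addrCA subrr addr0 rgamma2; apply; apply/andP; split; lra.
have s12 : 2 <= s - 1 by lra.
have : rgamma (s - 1) <= 1 by apply: IH => //; move: sn; rewrite -natr1; lra.
apply: le_trans; rewrite [leRHS]rgammaS subrK ler_peMl//; last by lra.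
by rewrite ltW// rgamma_gt0//; lra.
Qed.

Lemma rgamma_le2 s : 1 <= s -> rgamma s <= 2.
Proof.
move=> s1; have [s2|s2] := leP 2 s; first by apply: le_trans (rgamma_le1 s2) _; lra.
have G1 := @rgamma_le1 (s + 1); rewrite rgammaS.
have {}G1 : rgamma (s + 1) <= 1 by apply: G1; lra.
have : 0 < rgamma (s + 1) by rewrite rgamma_gt0//; lra.
nra.
Qed.

(** The decrease over a step h is at most h ln s times the value at s, and
    ln s <= s - 1 turns this into h times the value at s - 1. *)
Lemma rgamma_step_ge s h : 2 <= s -> 0 <= h <= 1 ->
  rgamma s - rgamma (s + h) <= 2 * h.
Proof.
move=> s2 h01; have /andP[h0 h1] := h01.
have s0 : 0 < s by lra.
have w := rgamma_wendel s0 h01.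
have G1 : rgamma (s - 1) <= 2 by rewrite rgamma_le2//; lra.
have E : rgamma (s - 1) = (s - 1) * rgamma s by rewrite rgammaS subrK.
have G0 := rgamma_gt0 s0.
have L : expR (- (h * ln s)) * rgamma s <= rgamma (s + h).
  move: w; rewrite /powR gt_eqF// => w.
  by rewrite expRN mulrC ler_pdivrMr ?expR_gt0// mulrC.
have e1 := expR_ge1Dx (- (h * ln s)).
have l1 := ln_le_sub1 s0.
have e2 : 1 - h * (s - 1) <= expR (- (h * ln s)).
  by apply: le_trans e1; rewrite lerD2l lerN2 ler_wpM2l.
have : (1 - h * (s - 1)) * rgamma s <= rgamma (s + h).
  by apply: le_trans L; rewrite ler_wpM2r// ltW.
have : h * rgamma (s - 1) <= h * 2 by rewrite ler_wpM2l.
rewrite E; lra.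
Qed.

(** For steps longer than 1, because the values lie in ]0, 1]. *)
Lemma rgamma_lipschitz s t : 2 <= s -> 2 <= t ->
  `|rgamma s - rgamma t| <= 2 * `|s - t|.
Proof.
wlog st : s t / s <= t => [H s2 t2|s2 t2].
  have [/H|/ltW/H] := leP s t; first exact.
  by rewrite distrC [`|s - t|]distrC; exact.
rewrite [`|s - t|]distrC (ger0_norm (_ : 0 <= t - s)) ?subr_ge0//.
have [h1|h1] := leP (t - s) 1.
  have h01 : 0 <= t - s <= 1 by rewrite subr_ge0 st.
  have := rgamma_step_ge s2 h01; have := rgamma_step_le s2 h01.
  rewrite addrCA subrr addr0 => ? ?.
  by rewrite ger0_norm ?subr_ge0.
have := rgamma_le1 s2; have := rgamma_le1 t2.
have : 0 < rgamma s by rewrite rgamma_gt0//; lra.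
have : 0 < rgamma t by rewrite rgamma_gt0//; lra.
by move=> *; rewrite ler_norml; apply/andP; split; lra.
Qed.

End ReciprocalGamma.

(** * Differentiability of the reciprocal Gamma function *)

Section RgammaDerivable.
Variable R : realType.
Implicit Types (s t h c : R) (n m : nat).
Notation rgamma := (@rgamma R).

Lemma cvg_slopeP (f : R -> R) (a d : R) :
  is_derive a 1 f d <-> h^-1 * (f (a + h) - f a) @[h --> 0^'] --> d.
Proof.
have E : (fun h : R => h^-1 *: ((f \o shift a) (h *: (1 : R)) - f a)) =
         (fun h : R => h^-1 * (f (a + h) - f a)).
  by apply/funext => h /=; rewrite /GRing.scale /= mulr1 [h + a]addrC.
split=> [[]|h].
  rewrite /derivable /derive E => c <-; exact: c.
have c : derivable f a 1 by rewrite /derivable E; apply/cvg_ex; exists d.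
split=> //; rewrite /derive E; apply: cvg_lim => //.
Qed.

(** The rising factorial that moves the argument from 2 + h to n + 2 + h in the
    functional equation. *)
Definition rising n h : R := \prod_(i < n) (2 + h + i%:R).

Lemma rgamma_rising n h : rgamma (2 + h) = rising n h * rgamma (n.+2%:R + h).
Proof.
rewrite /rising; elim: n => [|n IH]; first by rewrite big_ord0 mul1r.
rewrite big_ord_recr /= IH -mulrA [in LHS]rgammaS; congr (_ * (_ * _)).
  by rewrite -addn2 natrD; ring.
by congr rgamma; rewrite -[n.+3]addn1 natrD; ring.
Qed.

Lemma rising_gt0 n h : -1 <= h -> 0 < rising n h.
Proof.
by move=> h1; apply: prodr_gt0 => i _; rewrite ltr_wpDr//; lra.
Qed.

Lemma derivable_rising n h : derivable (rising n) h 1.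
Proof.
rewrite /rising; elim: n => [|n IH].
  under eq_fun do rewrite big_ord0.
  exact: derivable_cst.
under eq_fun do rewrite big_ord_recr /=.
by apply: derivableM; [exact: IH|exact: ex_derive].
Qed.

(** Wendel's inequality in the form shared by both signs of h: the slope of the
    reciprocal Gamma function at s lies between those of its value at s times
    c^(-h), for c = s and c = s - 1. *)
Lemma rgamma_slope_bounds s h : 2 <= s -> h != 0 -> `|h| <= 1 ->
  h^-1 * (rgamma s * s `^ (- h)) <= h^-1 * rgamma (s + h)
     <= h^-1 * (rgamma s * (s - 1) `^ (- h)).
Proof.
move=> s2 hn h1; have s0 : 0 < s by lra. have s10 : 0 < s - 1 by lra.
have [h0|h0] := ltP 0 h.
  have h01 : 0 <= h <= 1 by rewrite ltW//= (le_trans (ler_norm h)).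
  rewrite !ler_pM2l ?invr_gt0// !powRN; apply/andP; split.
    by rewrite ler_pdivrMr ?powR_gt0// mulrC rgamma_wendel.
  rewrite ler_pdivlMr ?powR_gt0// mulrC.
  apply: le_trans (rgamma_wendel_lower _ h01); last by lra.
  rewrite ler_wpM2r//; first by rewrite ltW// rgamma_gt0// addr_gt0.
  by rewrite ge0_ler_powR ?nnegrE//; lra.
have hlt0 : h < 0 by rewrite lt_neqAle hn.
have h01 : 0 <= - h <= 1.
  by rewrite oppr_ge0 h0 /= -[- h]ger0_norm ?oppr_ge0// normrN.
have sh0 : 0 < s + h by case/andP: h01 => ? ?; lra.
rewrite !ler_nM2l ?invr_lt0//; apply/andP; split.
  have := rgamma_wendel sh0 h01; rewrite addrK => /le_trans; apply.
  rewrite mulrC ler_wpM2l//; first by rewrite ltW// rgamma_gt0.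
  by rewrite ge0_ler_powR ?nnegrE//; case/andP: h01 => ? ?; lra.
have := @rgamma_wendel_lower R (s + h) (- h) _ h01.
rewrite addrK addrAC addrK mulrC; apply.
lra.
Qed.

Lemma is_derive_powRN c : 0 < c ->
  is_derive (0 : R) (1 : R) (fun h : R => c `^ (- h)) (- ln c).
Proof.
move=> c0; rewrite /powR (gt_eqF c0).
by apply: is_derive_eq; rewrite /GRing.scale /= oppr0 mul0r expR0; ring.
Qed.

(** Moving to n + 2 by the functional equation, the two bounds on the slope at 2
    have limits that differ by ln (n + 2) - ln (n + 1), so the slopes form a
    Cauchy filter. *)
Lemma derivable_rgamma2 : derivable rgamma 2 1.
Proof.
pose q (h : R) := h^-1 * (rgamma (2 + h) - rgamma 2).
suff : cvg (q h @[h --> 0^']).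
  by move=> /cvg_ex[l /cvg_slopeP[]].
apply/cauchy_cvgP; apply: cauchy_exP => e e0.
have [n ne] : exists n : nat, 3 / e < n.+1%:R.
  exists (Num.truncn (3 / e)).
  by case/andP: (truncn_itv (divr_ge0 (ler0n R 3) (ltW e0))).
have m0 : 0 < n.+1%:R :> R by rewrite ltr0n.
pose m : R := n.+2%:R.
have m1 : m - 1 = n.+1%:R by rewrite /m -[n.+2]addn1 natrD addrK.
have m2 : 2 <= m by rewrite /m ler_nat.
have m0' : 0 < m by rewrite ltr0n.
have m10 : 0 < m - 1 by rewrite m1.
pose L c h := rising n h * (rgamma m * c `^ (- h)).
have L0 c : L c 0 = rgamma 2.
  by rewrite /L oppr0 powRr0 mulr1 -[m]addr0 -rgamma_rising addr0.
pose p := 'D_1 (rising n) 0 * rgamma m.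
have dL c : 0 < c -> h^-1 * (L c h - rgamma 2) @[h --> 0^'] --> p - ln c.
  move=> c0; have dr : is_derive (0 : R) 1 (rising n) ('D_1 (rising n) 0).
    by apply/derivableP; exact: derivable_rising.
  have dc := is_derive_powRN c0.
  have : is_derive (0 : R) 1 (L c) (p - ln c).
    apply: is_derive_eq.
    rewrite /GRing.scale /= oppr0 powRr0 /p.
    have := L0 c; rewrite /L oppr0 powRr0 mulr1 rgamma2 => h.
    transitivity (- ln c * (rising n 0 * rgamma m) +
      rgamma m * 'D_1 (rising n) 0); first by ring.
    by rewrite h; ring.
  by move/cvg_slopeP; under eq_fun do rewrite add0r L0.
have lnm : ln m - ln (m - 1) < e / 3.
  rewrite -ln_div ?posrE//.
  apply: le_lt_trans (ln_le_sub1 _) _; first by rewrite divr_gt0.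
  have -> : m / (m - 1) - 1 = (m - 1)^-1 by field; rewrite gt_eqF.
  rewrite m1 -[e / 3]invrK ltf_pV2 ?posrE ?invr_gt0 ?divr_gt0//.
  by rewrite invf_div.
have lnm0 : ln (m - 1) <= ln m by rewrite ler_ln ?posrE// gerBl.
exists (p - ln m).
have e3 : 0 < e / 3 by rewrite divr_gt0.
have N1 : \forall h \near 0^', `|p - ln m - (h^-1 * (L m h - rgamma 2))| < e / 3.
  by move/cvgrPdist_lt: (dL _ m0') => /(_ _ e3).
have N2 : \forall h \near 0^',
    `|p - ln (m - 1) - (h^-1 * (L (m - 1) h - rgamma 2))| < e / 3.
  by move/cvgrPdist_lt: (dL _ m10) => /(_ _ e3).
change (\forall h \near 0^', ball (p - ln m) e (q h)).
near=> h.
have n1 : `|p - ln m - (h^-1 * (L m h - rgamma 2))| < e / 3.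
  by near: h; exact: N1.
have n2 : `|p - ln (m - 1) - (h^-1 * (L (m - 1) h - rgamma 2))| < e / 3.
  by near: h; exact: N2.
have hn : h != 0 by near: h; exact: nbhs_dnbhs_neq.
have h1 : `|h| <= 1 by near: h; exact: dnbhs0_le.
have r0 : 0 < rising n h by rewrite rising_gt0//; move: h1; rewrite ler_norml => /andP[].
have /andP[b1 b2] := rgamma_slope_bounds m2 hn h1.
have c1 : h^-1 * (L m h - rgamma 2) <= q h.
  rewrite /q (rgamma_rising n h) /L !mulrBr lerD2r.
  by rewrite [leLHS](mulrCA h^-1) [leRHS](mulrCA h^-1) ler_pM2l//; exact: b1.
have c2 : q h <= h^-1 * (L (m - 1) h - rgamma 2).
  rewrite /q (rgamma_rising n h) /L !mulrBr lerD2r.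
  by rewrite [leLHS](mulrCA h^-1) [leRHS](mulrCA h^-1) ler_pM2l//; exact: b2.
move: n1 n2 c1 c2; rewrite !ltr_norml /ball /= ltr_norml.
clear -e0 lnm0 lnm; move: (ln m) (ln (m - 1)) (q h) lnm0 lnm => a b k.
move: (_ * (L m h - _)) (_ * (L (m - 1) h - _)) => u v ? ? /andP[? ?] /andP[? ?] ? ?.
by apply/andP; split; lra.
Unshelve. all: by end_near. Qed.

(** The functional equation carries differentiability from s to s + 1. *)
Lemma derivable_rgamma n : derivable rgamma n.+2%:R 1.
Proof.
elim: n => [|n IH]; first exact: derivable_rgamma2.
have nn0 : n.+2%:R != 0 :> R by rewrite pnatr_eq0.
have dg : derivable (fun s : R => rgamma s / s) n.+2%:R 1.
  by apply: derivableM; [exact: IH|apply: derivableV; [exact: nn0|exact: derivable_id]].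
have /cvg_slopeP c : is_derive (n.+2%:R : R) 1 (fun s : R => rgamma s / s)
    ('D_1 (fun s : R => rgamma s / s) n.+2%:R) by exact/derivableP.
have rS s : s != 0 -> rgamma (s + 1) = rgamma s / s.
  by move=> s0; rewrite [rgamma s]rgammaS mulrAC divff// mul1r.
have : is_derive (n.+3%:R : R) 1 rgamma ('D_1 (fun s : R => rgamma s / s) n.+2%:R).
  apply/cvg_slopeP; apply: cvg_trans c; apply: near_eq_cvg; near=> h.
  have -> : n.+3%:R = n.+2%:R + 1 :> R by rewrite -[n.+3]addn1 natrD.
  have sh : n.+2%:R + h != 0.
    have : `|h| < 1 by near: h; exact: dnbhs0_lt.
    rewrite ltr_norml => /andP[h1 _].
    have h2 : 1 <= n.+2%:R :> R by rewrite ler1n.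
    by rewrite gt_eqF//; lra.
  by rewrite [X in rgamma X - rgamma (_ + 1)]addrAC !rS.
by case.
Unshelve. all: by end_near. Qed.

End RgammaDerivable.

(** * Termwise differentiation of series *)

Section Tannery.
Variable R : realType.
Implicit Types (u M : R ^nat) (k n : nat).

Lemma series_dominated u M : (forall k, `|u k| <= M k) -> cvgn (series M) ->
  cvgn (series u) /\
  forall N, `|limn (series u) - series u N| <= limn (series M) - series M N.
Proof.
move=> uM cM.
have cu : cvgn (series u).
  apply: normed_cvg; apply: series_le_cvg cM => n /=; first exact: normr_ge0.
    exact: le_trans (normr_ge0 _) (uM n).
  exact: uM.
split=> // N.
have c1 : `|series u n - series u N| @[n --> \oo] --> `|limn (series u) - series u N|.
  by apply: cvg_norm; apply: cvgB; [exact: cu|exact: cvg_cst].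
have c2 : series M n - series M N @[n --> \oo] --> limn (series M) - series M N.
  by apply: cvgB; [exact: cM|exact: cvg_cst].
apply: (ler_cvg_to c1 c2); near=> n.
have Nn : (N <= n)%N by near: n; exact: nbhs_infty_ge.
rewrite !(sub_series_geq _ Nn).
apply: le_trans (ler_norm_sum _ _ _) _.
by apply: ler_sum => i _; exact: uM.
Unshelve. all: by end_near. Qed.

(** Dominated convergence for series: cut where the dominating tail is small;
    what remains is a finite sum. *)
Lemma tannery {T : topologicalType} (F : set_system T) {FF : ProperFilter F}
    (q : nat -> T -> R) (D M : R ^nat) :
  (forall k, q k t @[t --> F] --> D k) ->
  (\forall t \near F, forall k, `|q k t| <= M k) ->
  cvgn (series M) ->
  cvgn (series D) /\
  limn (series (q^~ t)) @[t --> F] --> limn (series D).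
Proof.
move=> qD qM cM.
have DM k : `|D k| <= M k.
  have c : `|q k t| @[t --> F] --> `|D k| by apply: cvg_norm; exact: qD.
  have c' : M k @[t --> F] --> M k by exact: cvg_cst.
  apply: (ler_cvg_to c c').

  by apply: filterS qM => t.
have [cD tD] := series_dominated DM cM.
split=> //; apply/cvgrPdist_lt => e e0.
have e3 : 0 < e / 3 by rewrite divr_gt0.
have [N tN] : exists N, limn (series M) - series M N < e / 3.
  have : series M @ \oo --> limn (series M) by [].
  move/cvgrPdist_lt => /(_ _ e3)[N _ /(_ N (leqnn N)) h].
  by exists N; exact: le_lt_trans (ler_norm _) h.
have fin : series (q^~ t) N @[t --> F] --> series D N.
  rewrite /series /=; elim: N {tN} => [|N IH].
    by under eq_fun do rewrite big_nil; rewrite big_nil; exact: cvg_cst.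
  under eq_fun do rewrite big_nat_recr /=//; rewrite big_nat_recr /=//.
  by apply: cvgD; [exact: IH|exact: qD].
have fin' : \forall t \near F, `|series D N - series (q^~ t) N| < e / 3.
  by move/cvgrPdist_lt: fin => /(_ _ e3).
near=> t.
have qMt : forall k, `|q k t| <= M k by near: t; exact: qM.
have n1 : `|series D N - series (q^~ t) N| < e / 3 by near: t; exact: fin'.
have [_ /(_ N) tq] := series_dominated qMt cM.
move: n1 tq {tD}(tD N) tN.
move: (series D N) (series (q^~ t) N) (limn (series D)) (limn (series (q^~ t))).
move: (limn (series M)) (series M N) => m1 m2 d1 d2 d3 d4.
rewrite !ltr_norml !ler_norml => /andP[? ?] /andP[? ?] /andP[? ?] ?.
by apply/andP; split; lra.
Unshelve. all: by end_near. Qed.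

(** A bound on the increments of the terms that is linear in h dominates their
    difference quotients, to which dominated convergence applies. *)
Lemma is_derive_series (f : nat -> R -> R) (a : R) M :
  (forall k, derivable (f k) a 1) ->
  (\forall h \near 0^', forall k, `|f k (a + h) - f k a| <= `|h| * M k) ->
  cvgn (series M) -> cvgn (series (f^~ a)) ->
  cvgn (series (fun k => 'D_1 (f k) a)) /\
  is_derive a 1 (fun s => limn (series (f^~ s)))
    (limn (series (fun k => 'D_1 (f k) a))).
Proof.
move=> df fM cM cf.
pose q k h := h^-1 * (f k (a + h) - f k a).
have qD k : q k h @[h --> 0^'] --> 'D_1 (f k) a.
  exact: (cvg_slopeP (f k) a _).1 (derivableP (df k)).
have qM : \forall h \near 0^', forall k, `|q k h| <= M k.
  near=> h => k.
  have hn : h != 0 by near: h; exact: nbhs_dnbhs_neq.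
  have : forall k, `|f k (a + h) - f k a| <= `|h| * M k by near: h; exact: fM.
  by rewrite normrM normfV mulrC ler_pdivrMr ?normr_gt0// mulrC.
have [cD lq] := tannery qD qM cM.
split; first exact: cD.
apply: (cvg_slopeP _ a _).2; apply: cvg_trans lq; apply: near_eq_cvg; near=> h.
have hn : h != 0 by near: h; exact: nbhs_dnbhs_neq.
have qMh : forall k, `|q k h| <= M k by near: h; exact: qM.
have [cq _] := series_dominated qMh cM.
have E : limn (series (f^~ (a + h))) =
         limn (series (f^~ a)) + h * limn (series (q^~ h)).
  apply/cvg_lim => //.
  have -> : series (f^~ (a + h)) = (fun n => series (f^~ a) n + h * series (q^~ h) n).
    apply/funext => n; rewrite /series /= mulr_sumr -big_split /=.
    by apply: eq_bigr => k _; rewrite /q; field.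
  by apply: cvgD; [exact: cf|apply: cvgMr; exact: cq].
by rewrite E [X in X - _]addrC addrK mulKf.
Unshelve. all: by end_near. Qed.

End Tannery.

(** * The Bessel series as a function of its order *)

Section ExpCoeff.
Variables (R : realType) (x : R).
Implicit Types (u : R ^nat) (k n : nat).

Lemma exp_coeffS k : k.+1%:R * exp_coeff x k.+1 = x * exp_coeff x k.
Proof.
have : k.+1%:R != 0 :> R by rewrite pnatr_eq0.
rewrite /exp_coeff /= exprS factS natrM invfM.
move: (k.+1%:R) (k`!%:R^-1) => a b a0; transitivity (a / a * (x * (x ^+ k * b))).
  by ring.
by rewrite divff// mul1r.
Qed.

Lemma norm_exp_coeff k : `|exp_coeff x k| = exp_coeff `|x| k.
Proof. by rewrite /exp_coeff /= normrM normfV normrX normr_nat. Qed.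

(** The factor k cancels against k!, which shifts the index by one and brings out
    a factor x. *)
Lemma cvg_series_exp_coeff_muln u (l : R) :
  series (fun k => exp_coeff x k * u k.+1) @ \oo --> l ->
  series (fun k => exp_coeff x k * (k%:R * u k)) @ \oo --> x * l.
Proof.
move=> c; rewrite -cvg_shiftS.
have -> : [sequence series (fun k => exp_coeff x k * (k%:R * u k)) n.+1]_n =
          (fun n => x * series (fun k => exp_coeff x k * u k.+1) n).
  apply/funext => n; rewrite /series /= big_nat_recl// mul0r mulr0 add0r mulr_sumr.
  by apply: eq_bigr => k _; rewrite [RHS]mulrA -exp_coeffS; ring.
by apply: cvgMr.
Qed.

End ExpCoeff.

Section BesselSeries.
Variable R : realType.
Variable x : R.
Implicit Types (nu h : R) (u : R ^nat) (k n : nat).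
Notation rgamma := (@rgamma R).
Notation D := (fun s : R => 'D_1 rgamma s).

Definition bessel_term nu k := exp_coeff x k * rgamma (nu + k%:R + 1).

Definition bessel_sum nu := limn (series (bessel_term nu)).

(** The functional equation 1 / Gamma(nu + k) = (nu + k) / Gamma(nu + k + 1),
    with the factor nu + k split. *)
Lemma bessel_term_pred nu k : bessel_term (nu - 1) k =
  nu * bessel_term nu k + exp_coeff x k * (k%:R * rgamma (nu + k%:R + 1)).
Proof.
rewrite /bessel_term (rgammaS (nu - 1 + k%:R + 1)).
by rewrite (_ : nu - 1 + k%:R + 1 = nu + k%:R); ring.
Qed.

Lemma cvg_bessel_pred nu :
  cvgn (series (bessel_term nu)) -> cvgn (series (bessel_term (nu + 1))) ->
  series (bessel_term (nu - 1)) @ \oo -->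
    nu * bessel_sum nu + x * bessel_sum (nu + 1).
Proof.
move=> c0 c1.
have -> : series (bessel_term (nu - 1)) = (fun n => nu * series (bessel_term nu) n +
   series (fun k => exp_coeff x k * (k%:R * rgamma (nu + k%:R + 1))) n).
  apply/funext => n; rewrite /series /= mulr_sumr -big_split /=.
  by apply: eq_bigr => k _; rewrite bessel_term_pred.
apply: cvgD; first by apply: cvgMr; exact: c0.
apply: (@cvg_series_exp_coeff_muln R x (fun k => rgamma (nu + k%:R + 1))).
have -> : (fun k => exp_coeff x k * rgamma (nu + k.+1%:R + 1)) = bessel_term (nu + 1).
  apply/funext => k; rewrite /bessel_term; congr (_ * rgamma _).
  by rewrite -natr1; ring.
exact: c1.
Qed.

(** For nu >= 1 all values of the reciprocal Gamma function are at most 1; lower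
    orders follow by the recurrence. *)
Lemma cvg_bessel nu : cvgn (series (bessel_term nu)).
Proof.
have [n nnu] : exists n : nat, 1 - n%:R <= nu.
  exists (Num.truncn (1 - nu)).+1.
  have [h|h] := leP 0 (1 - nu); first by case/andP: (truncn_itv h) => _ ?; lra.
  have : 0 <= (Num.truncn (1 - nu)).+1%:R :> R by []. lra.
elim: n nu nnu => [|n IH] nu nnu.
  apply: (series_dominated _ (is_cvg_series_exp_coeff `|x|)).1 => k.
  rewrite /bessel_term normrM norm_exp_coeff ler_piMr//.
    by rewrite -norm_exp_coeff.
  have s2 : 2 <= nu + k%:R + 1 by have : 0 <= k%:R :> R by []; move: nnu; lra.
  by rewrite gtr0_norm ?rgamma_le1// rgamma_gt0//; lra.
have c0 : cvgn (series (bessel_term (nu + 1))).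
  by apply: IH; move: nnu; rewrite -natr1; lra.
have c1 : cvgn (series (bessel_term (nu + 1 + 1))).
  by apply: IH; move: nnu; rewrite -natr1; lra.
have := cvg_bessel_pred c0 c1; rewrite addrK => c.
by apply/cvg_ex; eexists; exact: c.
Qed.

Lemma bessel_sum_pred nu :
  bessel_sum (nu - 1) = nu * bessel_sum nu + x * bessel_sum (nu + 1).
Proof. by apply/cvg_lim => //; apply: cvg_bessel_pred; exact: cvg_bessel. Qed.

(** The recurrence, differentiated in nu.  The orders [lo] and [hi] are variables
    so that the lemma applies to numerals. *)
Lemma is_derive_bessel_pred (lo nu hi d0 d1 : R) :
  lo = nu - 1 -> hi = nu + 1 ->
  is_derive nu 1 bessel_sum d0 -> is_derive hi 1 bessel_sum d1 ->
  is_derive lo 1 bessel_sum (bessel_sum nu + nu * d0 + x * d1).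
Proof.
move=> -> -> /cvg_slopeP h0 /cvg_slopeP h1; apply/cvg_slopeP.
have -> : (fun h => h^-1 * (bessel_sum (nu - 1 + h) - bessel_sum (nu - 1))) =
  (fun h => h^-1 * h * bessel_sum (nu + h)
       + nu * (h^-1 * (bessel_sum (nu + h) - bessel_sum nu))
       + x * (h^-1 * (bessel_sum (nu + 1 + h) - bessel_sum (nu + 1)))).
  apply/funext => h; rewrite bessel_sum_pred.
  have -> : nu - 1 + h = nu + h - 1 by ring.
  rewrite bessel_sum_pred.
  have -> : nu + h + 1 = nu + 1 + h by ring.
  by ring.
have c : bessel_sum (nu + h) @[h --> 0^'] --> bessel_sum nu.
  have : (h * (h^-1 * (bessel_sum (nu + h) - bessel_sum nu)) + bessel_sum nu)
      @[h --> 0^'] --> 0 * d0 + bessel_sum nu.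
    apply: cvgD; last exact: cvg_cst.
    by apply: cvgM => //; apply: cvg_within.
  rewrite mul0r add0r; apply: cvg_trans; apply: near_eq_cvg; near=> h.
  have hn : h != 0 by near: h; exact: nbhs_dnbhs_neq.
  by rewrite mulVKf// subrK.
apply: cvgD; last by apply: cvgMr.
apply: cvgD; last by apply: cvgMr.
apply: cvg_trans c; apply: near_eq_cvg; near=> h.
have hn : h != 0 by near: h; exact: nbhs_dnbhs_neq.
by rewrite mulVf// mul1r.
Unshelve. all: by end_near. Qed.

Let dominating k := 2 * exp_coeff `|x| k.

Let cvg_dominating : cvgn (series dominating).
Proof.
have -> : dominating = 2 *: exp_coeff `|x| by apply/funext => k.
exact: is_cvg_seriesZ (is_cvg_series_exp_coeff _).
Qed.

Let cvg_dominating_muln :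
  cvgn (series (fun k => exp_coeff `|x| k * (k%:R * 2))).
Proof.
have c : cvgn (series (fun k => exp_coeff `|x| k * 2)).
  rewrite (_ : (fun k => _) = dominating) //.
  by apply/funext => k; rewrite mulrC.
by apply/cvg_ex; eexists; apply: (cvg_series_exp_coeff_muln (u := fun=> 2)); exact: c.
Qed.

Lemma is_derive_bessel_term n k (nu : R) : nu = n.+2%:R ->
  is_derive nu 1 (bessel_term ^~ k) (exp_coeff x k * D (nu + k%:R + 1)).
Proof.
move=> nuE; apply: (cvg_slopeP _ _ _).2.
have -> : (fun h => h^-1 * (bessel_term (nu + h) k - bessel_term nu k)) =
  (fun h => exp_coeff x k * (h^-1 * (rgamma (nu + k%:R + 1 + h) - rgamma (nu + k%:R + 1)))).
  apply/funext => h; rewrite /bessel_term.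
  by rewrite (_ : nu + h + k%:R + 1 = nu + k%:R + 1 + h); ring.
apply: cvgMr; apply: (cvg_slopeP _ _ _).1.
have -> : nu + k%:R + 1 = (n + k).+1.+2%:R.
  by rewrite nuE -natrD natr1 -!addSn.
exact: (derivableP (@derivable_rgamma R (n + k).+1)).
Qed.

(** At the orders 2, 3, and so on, the arguments of the reciprocal Gamma function
    stay in [2, +oo[ when nu varies by less than 1, so the Lipschitz bound
    dominates. *)
Lemma is_derive_bessel n (nu : R) : nu = n.+2%:R ->
  cvgn (series (fun k => exp_coeff x k * D (nu + k%:R + 1))) /\
  is_derive nu 1 bessel_sum
    (limn (series (fun k => exp_coeff x k * D (nu + k%:R + 1)))).
Proof.
move=> nuE; have nu2 : 2 <= nu by rewrite nuE ler_nat.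
have d k := is_derive_bessel_term k nuE.
have -> : (fun k => exp_coeff x k * D (nu + k%:R + 1)) = (fun k => 'D_1 (bessel_term ^~ k) nu).
  by apply/funext => k; have [_ ->] := d k.
apply: (@is_derive_series _ _ _ dominating).
- by move=> k; have [] := d k.
- near=> h => k.
  have : `|h| < 1 by near: h; exact: dnbhs0_lt.
  rewrite ltr_norml => /andP[h1 h2].
  have k0 : 0 <= k%:R :> R by [].
  rewrite /bessel_term -mulrBr normrM norm_exp_coeff /dominating mulrA.
  rewrite [`|h| * 2]mulrC [leRHS]mulrC.
  rewrite ler_wpM2l -?norm_exp_coeff//.
  apply: le_trans (rgamma_lipschitz _ _) _; [lra|lra|].
  by rewrite (_ : _ - _ = h)//; ring.
- exact: cvg_dominating.
- exact: cvg_bessel.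
Unshelve. all: by end_near. Qed.

Lemma is_derive_wright_term k :
  is_derive (1 : R) 1 (fun a : R => exp_coeff x k * rgamma (a * k%:R + 2))
    (exp_coeff x k * (k%:R * D k.+2%:R)).
Proof.
have dG : is_derive (k.+2%:R : R) 1 rgamma (D k.+2%:R).
  exact: (derivableP (@derivable_rgamma R k)).
have dl : is_derive (1 : R) 1 (fun a : R => a * k%:R + 2) k%:R.
  by apply: is_derive_eq; rewrite /GRing.scale /=; ring.
rewrite (_ : k.+2%:R = 1 * k%:R + 2 :> R) in dG; last by rewrite -addn2 natrD mul1r.
have dc := @is_derive1_comp R rgamma (fun a => a * k%:R + 2) 1 _ _ dG dl.
apply: is_derive_eq.
by rewrite /GRing.scale /= (_ : k.+2%:R = 1 * k%:R + 2 :> R); [ring|rewrite -addn2 natrD mul1r].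
Qed.

Lemma wrightE (a : R) :
  wright a 2 x = limn (series (fun k => exp_coeff x k * rgamma (a * k%:R + 2))).
Proof.
rewrite /wright; congr (limn (series _)); apply/funext => k.
by rewrite /exp_coeff /rgamma /= invfM mulrA.
Qed.

(** The argument a k + 2 moves by k h when a moves by h, and never drops below 2;
    the Lipschitz bound thus costs a factor k, harmless against k!. *)
Lemma is_derive_wright d : is_derive (2 : R) 1 bessel_sum d ->
  is_derive (1 : R) 1 (fun a => wright a 2 x) (x * d).
Proof.
have [cD dD] := @is_derive_bessel 0 2 erefl.
move=> [_ <-]; have [_ ->] := dD.
rewrite (funext wrightE).
have d1 k := is_derive_wright_term k.
have E : (fun k => 'D_1 (fun a : R => exp_coeff x k * rgamma (a * k%:R + 2)) (1 : R)) =
         (fun k => exp_coeff x k * (k%:R * D k.+2%:R)).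
  by apply/funext => k; have [_ ->] := d1 k.
have cf : cvgn (series (fun k => exp_coeff x k * rgamma (1 * k%:R + 2))).
  have -> : (fun k => exp_coeff x k * rgamma (1 * k%:R + 2)) = bessel_term 1;
    last exact: cvg_bessel.
  by apply/funext => k; rewrite /bessel_term; congr (_ * rgamma _); ring.
have dd k : derivable (fun a : R => exp_coeff x k * rgamma (a * k%:R + 2)) 1 1 by case: (d1 k).
have := @is_derive_series _ (fun k a => exp_coeff x k * rgamma (a * k%:R + 2))
  1 _ dd _ cvg_dominating_muln cf.
case.
  near=> h => k.
  have : `|h| < 1 by near: h; exact: dnbhs0_lt.
  rewrite ltr_norml => /andP[h1 h2].
  have k0 : 0 <= k%:R :> R by [].
  have hk : 0 <= (1 + h) * k%:R by rewrite mulr_ge0//; lra.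
  rewrite -mulrBr normrM norm_exp_coeff [leRHS]mulrCA.
  rewrite ler_wpM2l -?norm_exp_coeff//.
  apply: le_trans (rgamma_lipschitz _ _) _; [lra|lra|].
  rewrite (_ : _ - _ = h * k%:R); last by ring.
  by rewrite normrM normr_nat mulrCA [k%:R * 2]mulrC mulrCA.
move=> _; rewrite E.
suff -> : limn (series (fun k => exp_coeff x k * (k%:R * D k.+2%:R))) =
          x * limn (series (fun k => exp_coeff x k * D (2 + k%:R + 1))) by [].
apply/cvg_lim => //; apply: (@cvg_series_exp_coeff_muln R x (fun k => D k.+2%:R)).
have -> : (fun k => exp_coeff x k * D k.+3%:R) =
    (fun k => exp_coeff x k * D (2 + k%:R + 1)); last exact: cD.
by apply/funext => k; congr (_ * D _); rewrite -(natrD _ 2) natr1.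
Unshelve. all: by end_near. Qed.

(** Four uses of the differentiated recurrence, from the orders 2 and 3 down to
    -2; the derivatives at 3, 1, 0 and -1 cancel. *)
Lemma is_derive_bessel_N2 d : is_derive (2 : R) 1 bessel_sum d ->
  is_derive (- 2 : R) 1 bessel_sum
    (2 * x * bessel_sum 1 - bessel_sum 0 + x ^+ 2 * d).
Proof.
move=> d2.
have [_ d3] := @is_derive_bessel 1 3 erefl.
set e := limn _ in d3.
have l1 : 1 = 2 - 1 :> R by ring. have h1 : 3 = 2 + 1 :> R by ring.
have d1 := is_derive_bessel_pred l1 h1 d2 d3.
have l0 : 0 = 1 - 1 :> R by ring. have h0 : 2 = 1 + 1 :> R by ring.
have d0 := is_derive_bessel_pred l0 h0 d1 d2.
have lN1 : -1 = 0 - 1 :> R by ring. have hN1 : 1 = 0 + 1 :> R by ring.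
have dN1 := is_derive_bessel_pred lN1 hN1 d0 d1.
have lN2 : -2 = -1 - 1 :> R by ring. have hN2 : 0 = -1 + 1 :> R by ring.
have dN2 := is_derive_bessel_pred lN2 hN2 dN1 d0.
apply: (is_derive_eq dN2).
have := bessel_sum_pred 0; rewrite sub0r add0r => ->.
by ring.
Qed.

Lemma bessel_sum_N2 : bessel_sum (- 2) = x ^+ 2 * bessel_sum 2.
Proof.
have := bessel_sum_pred (-1); rewrite addNr (_ : - 1 - 1 = - 2 :> R); last by ring.
have := bessel_sum_pred 0; rewrite sub0r add0r => -> ->.
have := bessel_sum_pred 1; rewrite subrr (_ : 1 + 1 = 2 :> R)// => ->.
by ring.
Qed.

End BesselSeries.

(** * Limits of complex values *)

Section ComplexLimits.
Local Open Scope complex_scope.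
Variable R : realType.
Local Notation C := (Cplx R).

Lemma normC_le (a b : R) : `|(a +i* b : C)| <= (`|a| + `|b|)%:C.
Proof.
rewrite normc_def /= lecR -[leRHS]ger0_norm ?addr_ge0//.
rewrite -sqrtr_sqr ler_wsqrtr// sqrrD -!normrX !(ger0_norm (sqr_ge0 _)).
by rewrite addrAC lerDl mulrn_wge0// mulr_ge0.
Qed.

Lemma cvg_complex {T : Type} (F : set_system T) {FF : Filter F} (u v : T -> R) (a b : R) :
  u t @[t --> F] --> a -> v t @[t --> F] --> b ->
  (u t +i* v t : C) @[t --> F] --> (a +i* b : C).
Proof.
move=> ua vb; apply/cvgrPdist_lt => e.
rewrite ltcE /= => /andP[/eqP e2 e1].
have e12 : 0 < complex.Re e / 2 by rewrite divr_gt0.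
have eE : e = (complex.Re e)%:C by apply/eqP; rewrite eq_complex /= e2 !eqxx.
have N1 : \forall t \near F, `|a - u t| < complex.Re e / 2.
  by move/cvgrPdist_lt: ua; apply.
have N2 : \forall t \near F, `|b - v t| < complex.Re e / 2.
  by move/cvgrPdist_lt: vb; apply.
near=> t.
have n1 : `|a - u t| < complex.Re e / 2 by near: t; exact: N1.
have n2 : `|b - v t| < complex.Re e / 2 by near: t; exact: N2.
apply: le_lt_trans (normC_le (a - u t) (b - v t)) _.
rewrite eE ltcR; lra.
Unshelve. all: by end_near. Qed.

Lemma cvg_toC {T : Type} (F : set_system T) {FF : Filter F} (u : T -> R) (a : R) :
  u t @[t --> F] --> a -> toC (u t) @[t --> F] --> toC a.
Proof. by move=> ua; apply: cvg_complex => //; exact: cvg_cst. Qed.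

Lemma series_toC (u : R ^nat) : series (fun k => toC (u k)) = (fun n => toC (series u n)).
Proof. by apply/funext => n; rewrite /series /= /toC rmorph_sum. Qed.

(** Derivatives are limits at 0, whereas K is defined by a limit at its order. *)
Lemma cvg_dnbhs_shift {V : topologicalType} (f : R -> V) (a : R) (F : set_system V) :
  f (a + h) @[h --> 0^'] --> F -> f t @[t --> a^'] --> F.
Proof.
move=> fF; have : (t - a) @[t --> a^'] --> 0^'.
  move=> P [e /= e0 eP]; exists e => //= t ta tna; apply: eP.
    by move: ta; rewrite /= sub0r opprB.
  by rewrite subr_eq0.
move=> /cvg_comp/(_ fF).
by under [X in X @ _ --> _ -> _]funext do rewrite /= addrCA subrr addr0.
Qed.

Lemma lhopital (f g : R -> R) (a df dg : R) :
  is_derive a 1 f df -> is_derive a 1 g dg -> f a = 0 -> g a = 0 -> dg != 0 ->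
  f t / g t @[t --> a^'] --> df / dg.
Proof.
move=> /cvg_slopeP cf /cvg_slopeP cg f0 g0 dg0; apply: cvg_dnbhs_shift.
have : (h^-1 * (f (a + h) - f a)) / (h^-1 * (g (a + h) - g a)) @[h --> 0^'] --> df / dg.
  by apply: cvgM => //; apply: cvgV.
apply: cvg_trans; apply: near_eq_cvg; near=> h.
have hn : h != 0 by near: h; exact: nbhs_dnbhs_neq.
by rewrite f0 g0 !subr0 invfM mulrACA divff ?mul1r// invr_neq0.
Unshelve. all: by end_near. Qed.

End ComplexLimits.

(** * Bessel functions at 2 sqrt x *)

Section BesselComplex.
Local Open Scope complex_scope.
Variable R : realType.
Local Notation C := (Cplx R).
Implicit Types (x l th mu : R) (w : C).

(** The point of polar coordinates (e^l, th). *)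
Definition cpolar l th : C := expR l * cos th +i* (expR l * sin th).

Lemma cpolar_neq0 l th : cpolar l th != 0.
Proof.
apply/eqP => -[] /eqP + /eqP; rewrite !mulf_eq0 !(gt_eqF (expR_gt0 _)) /=.
move=> /eqP c /eqP s.
by have := cos2Dsin2 th; rewrite c s expr0n /= addr0 => /eqP; rewrite eq_sym oner_eq0.
Qed.

(** The hypothesis says that th is the principal argument. *)
Lemma cpow_cpolar l th mu : clog (cpolar l th) = (l +i* th : C) ->
  cpow (cpolar l th) mu = cpolar (mu * l) (mu * th).
Proof.
move=> lE; rewrite /cpow (negPf (cpolar_neq0 l th)) lE /cexp /toC /cpolar.
by simpc.
Qed.

Lemma besselI_real x w mu : w ^+ 2 = toC x ->
  besselI mu (2 * w) = cpow w mu * toC (bessel_sum x mu).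
Proof.
move=> w2; rewrite /besselI mulrC.
have n2 : (2 : C) != 0 by rewrite pnatr_eq0.
have -> : 2 * w / 2 = w by field.
have -> : (2 * w) ^+ 2 / 4 = toC x by rewrite -w2; field.
rewrite mulrC; congr (_ * _).
have -> : (fun k : nat => toC x ^+ k / (k`!%:R * toC (Gamma (mu + k%:R + 1)))) =
   (fun k => toC (bessel_term x mu k)).
  apply/funext => k.
  rewrite /bessel_term /exp_coeff /rgamma; move: (Gamma _) => g.
  rewrite /toC /= !rmorphM !fmorphV rmorphXn rmorph_nat.
  by rewrite invfM mulrA.
rewrite series_toC; apply/cvg_lim => //.
by apply: cvg_toC; exact: cvg_bessel.
Qed.

(** For negative x the square root lies on the positive imaginary axis, so its
    argument is pi / 2 and doubles to the argument pi of x. *)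
Lemma csqrt_cpolar x : x != 0 -> exists l th,
  [/\ csqrt (toC x) = cpolar l th, clog (cpolar l th) = (l +i* th : C),
      clog (toC x) = (2 * l +i* (2 * th) : C),
      expR (2 * l) * cos (2 * th) = x & sin (2 * th) = 0].
Proof.
move=> x0.
have [xp|xn] := ltP 0 x.
  have sx : 0 < Num.sqrt x by rewrite sqrtr_gt0.
  exists (ln (Num.sqrt x)), 0.
  have nr (y : R) : 0 < y -> clog (toC y) = (ln y +i* 0 : C).
    move=> y0; rewrite /clog /carg /toC /= lexx expr0n /= addr0 sqrtr_sqr gtr0_norm//.
    by rewrite divff ?acos1// gt_eqF.
  have l2 : 2 * ln (Num.sqrt x) = ln x.
    by rewrite -{2}(sqr_sqrtr (ltW xp)) lnXn// mulr_natl.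
  have E : cpolar (ln (Num.sqrt x)) 0 = toC (Num.sqrt x).
    by rewrite /cpolar cos0 sin0 mulr1 mulr0 lnK.
  split.
  - by rewrite E /csqrt sqrtc_sqrtr// lecR ltW.
  - by rewrite E nr.
  - by rewrite nr// l2 mulr0.
  - by rewrite l2 mulr0 cos0 mulr1 lnK.
  - by rewrite mulr0 sin0.
have xlt : x < 0 by rewrite lt_neqAle x0.
have nx0 : 0 < - x by rewrite oppr_gt0.
have sx : 0 < Num.sqrt (- x) by rewrite sqrtr_gt0.
exists (ln (Num.sqrt (- x))), (pi / 2).
have l2 : 2 * ln (Num.sqrt (- x)) = ln (- x).
  by rewrite -{2}(sqr_sqrtr (ltW nx0)) lnXn// mulr_natl.
have p2 : 2 * (pi / 2) = pi :> R by field.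
have E : cpolar (ln (Num.sqrt (- x))) (pi / 2) = (0 +i* Num.sqrt (- x) : C).
  by rewrite /cpolar cos_pihalf sin_pihalf mulr1 mulr0 lnK.
split.
- rewrite E /csqrt /toC /= eqxx mul1r expr0n /= addr0 sqrtr_sqr ltr0_norm//.
  by rewrite addNr mul0r sqrtr0 (_ : (- x - x) / 2 = - x)//; field.
- rewrite E /clog /carg /= ltW// expr0n /= add0r sqrtr_sqr gtr0_norm//.
  by rewrite mul0r acos0.
- rewrite l2 p2 /clog /carg /toC /= lexx expr0n /= addr0 sqrtr_sqr ltr0_norm//.
  by rewrite invrN mulrN divff// acosN1.
- by rewrite l2 p2 cospi lnK// mulrN1 opprK.
- by rewrite p2 sinpi.
Qed.

Lemma is_derive_cpolar_Re l th mu :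
  is_derive mu 1 (fun v => expR (v * l) * cos (v * th))
    (l * (expR (mu * l) * cos (mu * th)) - th * (expR (mu * l) * sin (mu * th))).
Proof.
have de : is_derive mu (1:R) (fun v : R => expR (v * l)) (expR (mu * l) * l).
  by apply: is_derive_eq; rewrite /GRing.scale /=; ring.
have dl : is_derive mu (1:R) (fun v : R => v * th) th.
  by apply: is_derive_eq; rewrite /GRing.scale /=; ring.
have dc := @is_derive1_comp R cos (fun v => v * th) mu _ _ (is_derive_cos _) dl.
apply: (is_derive_eq (is_deriveM de dc)).
by rewrite /GRing.scale /=; ring.
Qed.

Lemma is_derive_cpolar_Im l th mu :
  is_derive mu 1 (fun v => expR (v * l) * sin (v * th))
    (l * (expR (mu * l) * sin (mu * th)) + th * (expR (mu * l) * cos (mu * th))).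
Proof.
have de : is_derive mu (1:R) (fun v : R => expR (v * l)) (expR (mu * l) * l).
  by apply: is_derive_eq; rewrite /GRing.scale /=; ring.
have dl : is_derive mu (1:R) (fun v : R => v * th) th.
  by apply: is_derive_eq; rewrite /GRing.scale /=; ring.
have dc := @is_derive1_comp R sin (fun v => v * th) mu _ _ (is_derive_sin _) dl.
apply: (is_derive_eq (is_deriveM de dc)).
by rewrite /GRing.scale /=; ring.
Qed.

(** For f the real or the imaginary part of the power w^mu and g the Bessel
    series, this is the numerator of the quotient that defines K. *)
Lemma is_derive_reflected (f g : R -> R) (a fp fm gp gm : R) :
  is_derive a 1 f fp -> is_derive (- a) 1 f fm ->
  is_derive a 1 g gp -> is_derive (- a) 1 g gm ->
  is_derive a 1 (fun v => f (- v) * g (- v) - f v * g v)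
    (- (fm * g (- a) + f (- a) * gm) - (fp * g a + f a * gp)).
Proof.
move=> f1 f2 g1 g2.
have dn : is_derive a (1:R) (fun v : R => - v) (- 1).
  by apply: is_derive_eq.
have f2' := @is_derive1_comp R f (fun v => - v) a _ _ f2 dn.
have g2' := @is_derive1_comp R g (fun v => - v) a _ _ g2 dn.
apply: (is_derive_eq (is_deriveB (is_deriveM f2' g2') (is_deriveM f1 g1))).
by rewrite /GRing.scale /=; ring.
Qed.

End BesselComplex.

(** * The function K of order 2 and the derivative of the Wright function *)

Section BesselK2.
Local Open Scope complex_scope.
Variable R : realType.
Local Notation C := (Cplx R).
Implicit Types (x l th mu : R) (w : C).

(** The quotient defining K splits into a real and an imaginary one, both of
    the indeterminate form 0 / 0 at the order 2, where the derivative of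
    sin (mu pi) is pi. *)
Lemma besselK2_cpolar x l th d : x != 0 ->
  clog (cpolar l th) = (l +i* th : C) ->
  expR (2 * l) * cos (2 * th) = x -> sin (2 * th) = 0 ->
  cpolar l th ^+ 2 = toC x ->
  is_derive (2 : R) 1 (bessel_sum x) d ->
  besselK 2 (2 * cpolar l th) =
    ((bessel_sum x 0 / (2 * x) - bessel_sum x 1 - x * d
       - l * x * bessel_sum x 2) +i* (- (th * x * bessel_sum x 2)) : C).
Proof.
move=> x0 clogE cosE sinE w2 d2.
have sin2pi0 : sin (2 * pi) = 0 :> R by rewrite mulr_natl sin2pi.
rewrite /besselK sin2pi0 eqxx.
pose A v := expR (v * l) * cos (v * th).
pose B v := expR (v * l) * sin (v * th).
pose S := bessel_sum x.
(* cos (2 th) is the sign of x, so e^(2 l) = x cos (2 th) as well. *)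
have e2 : expR (2 * l) = x / cos (2 * th).
  rewrite -cosE mulfK//; apply: contraNneq x0 => c0; rewrite -cosE c0 mulr0//.
have c2 : cos (2 * th) ^+ 2 = 1.
  by rewrite -[LHS](addr0) -[X in _ + X](expr0n _ 2) -sinE cos2Dsin2.
have c0 : cos (2 * th) != 0.
  by apply/eqP => h; move: c2; rewrite h expr0n /= => /eqP; rewrite eq_sym oner_eq0.
have A2 : A 2 = x by [].
have B2 : B 2 = 0 by rewrite /B sinE mulr0.
have AN2 : A (- 2) = x^-1.
  rewrite /A !mulNr cosN expRN e2 invf_div mulrAC -expr2 c2; field.
  exact: x0.
have BN2 : B (- 2) = 0 by rewrite /B !mulNr sinN sinE oppr0 mulr0.
have SN2 : S (- 2) = x ^+ 2 * S 2 := bessel_sum_N2 x.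
have dS := is_derive_bessel_N2 d2.
set dN := _ + _ in dS.
pose nA := - ((l * A (- 2) - th * B (- 2)) * S (- 2) + A (- 2) * dN)
  - ((l * A 2 - th * B 2) * S 2 + A 2 * d).
pose nB := - ((l * B (- 2) + th * A (- 2)) * S (- 2) + B (- 2) * dN)
  - ((l * B 2 + th * A 2) * S 2 + B 2 * d).
have dNA : is_derive (2 : R) 1 (fun v => A (- v) * S (- v) - A v * S v) nA.
  exact: is_derive_reflected (is_derive_cpolar_Re l th 2)
    (is_derive_cpolar_Re l th (- 2)) d2 dS.
have dNB : is_derive (2 : R) 1 (fun v => B (- v) * S (- v) - B v * S v) nB.
  exact: is_derive_reflected (is_derive_cpolar_Im l th 2)
    (is_derive_cpolar_Im l th (- 2)) d2 dS.
have ds : is_derive (2 : R) 1 (fun mu => sin (mu * pi)) pi.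
  have dl : is_derive (2 : R) (1:R) (fun v : R => v * pi) pi.
    by apply: is_derive_eq; rewrite /GRing.scale /=; ring.
  have := @is_derive1_comp R sin (fun v => v * pi) 2 _ _ (is_derive_sin _) dl.
  move/is_derive_eq; apply.
  by rewrite mulr_natl cos2pi mul1r.
have pi0 : pi != 0 :> R by rewrite gt_eqF// pi_gt0.
have NA0 : A (- 2) * S (- 2) - A 2 * S 2 = 0.
  by rewrite AN2 A2 SN2; field.
have NB0 : B (- 2) * S (- 2) - B 2 * S 2 = 0 by rewrite BN2 B2 !mul0r subrr.
have limA := lhopital dNA ds NA0 sin2pi0 pi0.
have limB := lhopital dNB ds NB0 sin2pi0 pi0.
apply/cvg_lim => //.
have -> : (fun mu => besselK_quot mu (2 * cpolar l th)) = (fun mu =>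
   (pi / 2 * ((A (- mu) * S (- mu) - A mu * S mu) / sin (mu * pi)) +i*
    (pi / 2 * ((B (- mu) * S (- mu) - B mu * S mu) / sin (mu * pi))) : C)).
  apply/funext => mu; rewrite /besselK_quot !(besselI_real _ w2) !(cpow_cpolar _ clogE).
  rewrite /toC -fmorphV /cpolar -/(A mu) -/(A (- mu)) -/(B mu) -/(B (- mu)) -/S.
  by simpc; congr (_ +i* _); ring.
have vA : S 0 / (2 * x) - S 1 - x * d - l * x * S 2 = pi / 2 * (nA / pi).
  rewrite /nA /dN AN2 BN2 A2 B2 SN2 -/S.
  move: (pi : R) pi0 => p p0; field.
  by rewrite p0 x0.
have vB : - (th * x * S 2) = pi / 2 * (nB / pi).
  rewrite /nB /dN AN2 BN2 A2 B2 SN2 -/S.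
  move: (pi : R) pi0 => p p0; field.
  by rewrite p0 x0.
rewrite -/S vA vB; apply: cvg_complex; apply: cvgMr; [exact: limA|exact: limB].
Qed.

End BesselK2.

Theorem theorem6p6 (R : realType) (x : R) (hx : x != 0) :
  let X := toC x in
  derivable (fun a : R => wright a 2 x) 1 1 /\
  toC (derive1 (fun a : R => wright a 2 x) 1) =
    1 / (2 * X) * besselI 0 (2 * csqrt X)
    - 1 / csqrt X * besselI 1 (2 * csqrt X)
    - 1 / 2 * clog X * besselI 2 (2 * csqrt X)
    - besselK 2 (2 * csqrt X).
Proof.
move=> X; have [_ d2] := @is_derive_bessel R x 0 2 erefl.
set d := limn _ in d2.
have [dW vW] := is_derive_wright d2; split; first exact: dW.
rewrite derive1E vW.
have [l [th [sqrtE clogE clogX cosE sinE]]] := csqrt_cpolar hx.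
have w2 : cpolar l th ^+ 2 = X by rewrite -sqrtE /csqrt sqr_sqrtc.
have X0 : X != 0.
  by apply/eqP => -[/eqP]; rewrite (negPf hx).
rewrite sqrtE (besselK2_cpolar hx clogE cosE sinE w2 d2) clogX.
rewrite !(besselI_real _ w2) !(cpow_cpolar _ clogE).
have p0 : cpolar (0 * l) (0 * th) = 1 by rewrite /cpolar !mul0r expR0 cos0 sin0 mulr1 mulr0.
have p2 : cpolar (2 * l) (2 * th) = X by rewrite /cpolar cosE sinE mulr0.
rewrite p0 p2 !mul1r.
move: (bessel_sum x 0) (bessel_sum x 1) (bessel_sum x 2) => s0 s1 s2.
rewrite (mulKf (cpolar_neq0 l th)).
have -> : (2 * X)^-1 * toC s0 = toC (s0 / (2 * x)).
  by rewrite /X /toC fmorph_div rmorphM rmorph_nat mulrC.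
rewrite /X /toC; apply/eqP; rewrite eq_complex; simpc.
apply/andP; split; apply/eqP.
  by rewrite /=; field; rewrite hx.
by rewrite /=; field.
Qed.
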